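(* For $i=1,2$ consider forward complete systems $\Sigma_i:\ \frac{d}{dt}x_i(t)=f_i(x_i(t),w_i(t))$ with $x_i(0)\in\mathbb{R}^{n_i}$, $w_i\in\mathcal{W}^{m_i}$, where $f_i:\mathbb{R}^{n_i}\times\mathbb{R}^{m_i}\to\mathbb{R}^{n_i}$ is locally Lipschitz in its first argument, locally uniformly in its second argument, and $m_1=n_2$, $m_2=n_1$. Suppose that there are $\beta_i,\gamma_i\in\mathcal{K}_\infty$ such that, for $i=1,2$, $$\|x_i\|_{\mathcal{L}_2[0,t]}^2\le\max\left\{\beta_i(|x_i(0)|),\ \gamma_i\left(\|w_i\|_{\mathcal{L}_2[0,t]}^2\right)\right\}$$ for all $x_i(0)\in\mathbb{R}^{n_i}$, $w_i\in\mathcal{W}^{m_i}$, $t\in\mathbb{R}_{\ge0}$. Consider the feedback interconnection given by $w_1=x_2+\eta_1$ and $w_2=x_1+\eta_2$ with external inputs $\eta_i\in\mathcal{W}^{m_i}$, assumed forward complete. Fix $\varepsilon>0$, let $\rho\in\mathcal{K}_\infty$ be such that $\rho-\mathrm{Id}\in\mathcal{K}_\infty$, and define, for $i=1,2$, $$\hat\gamma_i(s)=\gamma_i\circ\rho\left((1+\varepsilon^2)s\right),\quad s\in\mathbb{R}_{\ge0}.$$ If the small-gain conditions $$\mathrm{Id}-\hat\gamma_i\circ\hat\gamma_j\in\mathcal{K}_\infty$$ are satisfied for $i,j=1,2$, $i\ne j$, then the interconnected system has the nonlinear $\mathcal{L}_2$-gain property from input $\eta=[\eta_1^T\ \eta_2^T]^T$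 to state $x=[x_1^T\ x_2^T]^T$; that is, there exist $\beta,\gamma\in\mathcal{K}_\infty$ such that $$\|x\|_{\mathcal{L}_2[0,t]}^2\le\max\left\{\beta(|x(0)|),\ \gamma\left(\|\eta\|_{\mathcal{L}_2[0,t]}^2\right)\right\}$$ for all $x(0)\in\mathbb{R}^{n_1+n_2}$, $\eta\in\mathcal{W}^{m_1+m_2}$, $t\in\mathbb{R}_{\ge0}$.
   Context: $\mathcal{W}^m$ is the set of measurable, locally essentially bounded functions $w:\mathbb{R}_{\ge0}\to\mathbb{R}^m$. Forward complete means that for every initial condition and every input in the input class the solution exists for all $t\ge 0$. $\mathcal{K}_\infty$ is the class of continuous, strictly increasing, unbounded functions $\alpha:\mathbb{R}_{\ge0}\to\mathbb{R}_{\ge0}$ with $\alpha(0)=0$. $\mathrm{Id}$ is the identity on $\mathbb{R}_{\ge0}$; $\mathrm{Id}-g\in\mathcal{K}_\infty$ means that $s\mapsto s-g(s)$ is of class $\mathcal{K}_\infty$. $|\cdot|$ is the Euclidean norm, and $\|y\|_{\mathcal{L}_2[0,t]}^2:=\int_0^t|y(\tau)|^2d\tau$. *)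

(* Defs.v *)
From HB Require Import structures.
From mathcomp Require Import all_boot all_order all_algebra.
From mathcomp Require Import all_classical all_reals all_analysis.

Set Implicit Arguments.
Unset Strict Implicit.
Unset Printing Implicit Defensive.

Import Order.TTheory GRing.Theory Num.Theory.
Import numFieldNormedType.Exports.

Local Open Scope classical_set_scope.
Local Open Scope ring_scope.

(* Conventions.  R^n is 'cV[R]_n.  Functions on the half-line [0, +oo[ (inputs,
   trajectories, comparison functions) are total functions on R of which only
   the restriction to [0, +oo[ matters.  Measurability, "almost every" and
   integrals refer to the Lebesgue (completed) sigma-algebra and measure. *)

(* R with its Lebesgue sigma-algebra: the domain of
   completed_lebesgue_measure. *)
Notation lebesgueTypeR R := (caratheodory_type ((@wlength R idfun)^*)%mu).

Section Norms.
Variable R : realType.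

(* The library norm `|x| on matrices is the sup norm. *)
Definition enorm n (x : 'cV[R]_n) : R := Num.sqrt (\sum_i (x i 0) ^+ 2).

(* Squared norm of y in L_2[0, t].  It is only applied to functions that are
   measurable and essentially bounded on [0, t], for which the integral is
   finite. *)
Definition L2sq n (y : R -> 'cV[R]_n) (t : R) : R :=
  \int[completed_lebesgue_measure]_(s in `[0, t]) (enorm (y s) ^+ 2).

End Norms.

Section ComparisonFunctions.
Variable R : realType.

(* Nonnegativity on [0, +oo[ follows from the value 0 at 0 and monotonicity. *)
Definition classKinf (a : R -> R) : Prop :=
  [/\ a 0 = 0,
      {within `[0, +oo[, continuous a},
      forall s t : R, 0 <= s -> s < t -> a s < a t &
      forall M : R, exists2 s : R, 0 <= s & M <= a s].

End ComparisonFunctions.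

Section Systems.
Variable R : realType.

Definition admissible_input m (w : R -> 'cV[R]_m) : Prop :=
  (forall i, measurable_fun (`[0, +oo[ : set (lebesgueTypeR R))
                            (fun t => w t i 0)) /\
  (forall T : R, 0 <= T -> exists M : R,
     {ae completed_lebesgue_measure, forall t : R,
        0 <= t <= T -> enorm (w t) <= M}).

(* Absolute continuity on every [0, T]; s lists the end points of finitely
   many non-overlapping subintervals. *)
Definition locally_AC n (x : R -> 'cV[R]_n) : Prop :=
  forall T e : R, 0 <= T -> 0 < e -> exists2 d : R, 0 < d &
    forall s : seq (R * R),
      all (fun p => [&& 0 <= p.1, p.1 <= p.2 & p.2 <= T]) s ->
      pairwise (fun p q => (p.2 <= q.1) || (q.2 <= p.1)) s ->
      \sum_(p <- s) (p.2 - p.1) < d ->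
      \sum_(p <- s) enorm (x p.2 - x p.1) < e.

(* Caratheodory solutions on [0, +oo[ of dx/dt = f(x, w). *)
Definition solution n m (f : 'cV[R]_n -> 'cV[R]_m -> 'cV[R]_n)
    (w : R -> 'cV[R]_m) (x : R -> 'cV[R]_n) : Prop :=
  locally_AC x /\
  {ae completed_lebesgue_measure, forall t : R,
     0 <= t -> is_derive t (1 : R) x (f (x t) (w t))}.

(* The Lipschitz constant k is uniform for w near w0. *)
Definition locally_lipschitz_fst n m
    (f : 'cV[R]_n -> 'cV[R]_m -> 'cV[R]_n) : Prop :=
  forall (x0 : 'cV[R]_n) (w0 : 'cV[R]_m), exists k : R,
    exists2 U, nbhs x0 U & \forall w \near w0, k.-lipschitz_U (f ^~ w).

(* Uniqueness of the solution is a consequence of locally_lipschitz_fst. *)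
Definition forward_complete n m
    (f : 'cV[R]_n -> 'cV[R]_m -> 'cV[R]_n) : Prop :=
  forall (x0 : 'cV[R]_n) (w : R -> 'cV[R]_m), admissible_input w ->
    exists2 x, solution f w x & x 0 = x0.

Definition L2_gain_estimate n m (f : 'cV[R]_n -> 'cV[R]_m -> 'cV[R]_n)
    (beta gamma : R -> R) : Prop :=
  forall (w : R -> 'cV[R]_m) (x : R -> 'cV[R]_n),
    admissible_input w -> solution f w x ->
    forall t, 0 <= t ->
      L2sq x t <= Num.max (beta (enorm (x 0))) (gamma (L2sq w t)).

Definition nonlinear_L2_gain n m
    (f : 'cV[R]_n -> 'cV[R]_m -> 'cV[R]_n) : Prop :=
  exists beta gamma : R -> R,
    [/\ classKinf beta, classKinf gamma & L2_gain_estimate f beta gamma].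

(* State [x1; x2], input [eta1; eta2], w1 = x2 + eta1 and w2 = x1 + eta2. *)
Definition interconnection n1 n2
    (f1 : 'cV[R]_n1 -> 'cV[R]_n2 -> 'cV[R]_n1)
    (f2 : 'cV[R]_n2 -> 'cV[R]_n1 -> 'cV[R]_n2)
    (x : 'cV[R]_(n1 + n2)) (eta : 'cV[R]_(n2 + n1)) : 'cV[R]_(n1 + n2) :=
  let x1 := usubmx x in let x2 := dsubmx x in
  let eta1 := usubmx eta in let eta2 := dsubmx eta in
  col_mx (f1 x1 (x2 + eta1)) (f2 x2 (x1 + eta2)).

Definition gamma_hat (gamma rho : R -> R) (eps s : R) : R :=
  gamma (rho ((1 + eps ^+ 2) * s)).

End Systems.

(* Main.v *)
Require Import Defs.
From mathcomp Require Import all_boot all_order all_algebra.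
From mathcomp Require Import all_classical all_reals all_analysis.
From mathcomp Require Import measurable_realfun ring lra.
Import Order.TTheory GRing.Theory Num.Theory.
Import numFieldNormedType.Exports.
Local Open Scope classical_set_scope.
Local Open Scope ring_scope.

(* Young's inequality bounds the squared L2 norm of w1 = x2 + eta1 by
   (1 + eps^2) |x2|^2 + (1 + eps^-2) |eta1|^2, and rho separates the two terms:
   |x1|^2 <= max (m, g1 (|x2|^2)) and symmetrically |x2|^2 <= max (m, g2 (|x1|^2)),
   where g1, g2 are the hat gains and m depends only on |x(0)| and |eta|^2.
   Substituting, |x1|^2 <= g1 (g2 (|x1|^2)) forces |x1|^2 = 0 by the small-gain
   condition, so |x1|^2 <= max (m, g1 m) in every case.  A trajectory is itself
   an admissible input, being continuous. *)

(** * Calculus of class K-infinity functions and the scalar small-gain argument *)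

Section Kinf.
Context {R : realType}.
Implicit Types (a b g rho : R -> R).

Lemma Kinf_le {a} : classKinf a -> forall s t, 0 <= s -> s <= t -> a s <= a t.
Proof.
move=> [_ _ inc _] s t s0; rewrite le_eqVlt => /predU1P[->//|st].
exact/ltW/inc.
Qed.

Lemma Kinf_ge0 {a} : classKinf a -> forall s, 0 <= s -> 0 <= a s.
Proof. by move=> aK s s0; have [<- _ _ _] := aK; exact: Kinf_le. Qed.

Lemma Kinf_max {a} : classKinf a -> forall s t, 0 <= s -> 0 <= t ->
  a (Num.max s t) = Num.max (a s) (a t).
Proof.
move=> aK s t s0 t0; have [st|/ltW ts] := leP s t.
  by rewrite [RHS]max_r // (Kinf_le aK).
by rewrite [RHS]max_l // (Kinf_le aK).
Qed.

Lemma Kinf_surj {a} : classKinf a ->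
  forall M, 0 <= M -> exists2 s, 0 <= s & a s = M.
Proof.
move=> aK M M0; have [a0 ac _ aM] := aK; have [t t0 Mt] := aM M.
have act : {within `[0, t], continuous a}.
  apply: continuous_subspaceW ac => x /=; rewrite !in_itv/= => /andP[-> _] //.
have [|s] := @IVT _ a 0 t M t0 act.
  by rewrite a0 min_l ?max_r ?M0 ?(le_trans M0 Mt).
by rewrite in_itv/= => /andP[s0 _]; exists s.
Qed.

(** An increasing map that skips no value has no jump, so surjectivity yields continuity as well as
    unboundedness. Composites, scalings and inverses are then recognised by solving equations,
    without any limit argument. *)
Lemma inc_surj_Kinf {a} : a 0 = 0 ->
  (forall s t, 0 <= s -> s < t -> a s < a t) ->
  (forall M, 0 <= M -> exists2 s, 0 <= s & a s = M) -> classKinf a.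
Proof.
move=> a0 inc surj; split=> //; last first.
  move=> M; have [|s s0 sM] := surj (Num.max 0 M); first by rewrite le_max lexx.
  by exists s; rewrite // sM le_max lexx orbT.
have cts t : 0 < t -> {within `[0, t], continuous a}.
  move=> t0; apply: segment_inc_surj_continuous.
    move=> x y /[!in_itv]/= /andP[x0 _] /andP[y0 _].
    have [xy|yx|->] := ltgtP x y; last by rewrite lexx.
    - exact/ltW/inc.
    (* Monotonicity places the preimage of a value below [a t] inside [[0, t]], so [a] maps this
       segment onto [[a 0, a t]]. *)
    - by apply/negbTE; rewrite -ltNge inc.
  move=> y /=; rewrite in_itv/= a0 => /andP[y0 yt].
  have [s s0 sy] := surj y y0; exists s => //=.
  rewrite in_itv/= s0 leNgt; apply/negP => /(inc _ _ (ltW t0)).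
  by rewrite sy ltNge yt.
(* A point [x > 0] is interior to [[0, x + 1]]; right continuity at 0 is read off [[0, 1]]. *)
apply/continuous_within_itvcyP; split.
  move=> x; rewrite in_itv/= andbT => x0.
  have /cts/continuous_within_itvP : 0 < x + 1 by lra.
  by case=> [|+ _ _]; [lra|apply; rewrite in_itv/= x0/=; lra].
have /cts/continuous_within_itvP : 0 < 1 :> R by [].
by case.
Qed.

Lemma Kinf_comp {a b} : classKinf a -> classKinf b -> classKinf (a \o b).
Proof.
move=> aK bK; have [a0 _ ai _] := aK; have [b0 _ bi _] := bK.
apply: inc_surj_Kinf => /=; first by rewrite b0.
  by move=> s t s0 st; apply: ai; [exact: Kinf_ge0|exact: bi].
move=> M /(Kinf_surj aK)[s /(Kinf_surj bK)[t t0 <-] <-].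
by exists t.
Qed.

Lemma Kinf_add {a b} : classKinf a -> classKinf b ->
  classKinf (fun s => a s + b s).
Proof.
move=> aK bK; have [a0 ac ai aM] := aK; have [b0 bc bi _] := bK.
split; first by rewrite a0 b0 addr0.
- by move=> x; apply: cvgD; [exact: ac|exact: bc].
- by move=> s t s0 st; rewrite ltrD ?ai ?bi.
- move=> M; have [s s0 Ms] := aM M; exists s => //.
  by rewrite (le_trans Ms) // lerDl (Kinf_ge0 bK).
Qed.

Lemma Kinf_scale (c : R) : 0 < c -> classKinf (fun s => c * s).
Proof.
move=> c0; apply: inc_surj_Kinf; first by rewrite mulr0.
  by move=> s t _ st; rewrite ltr_pM2l.
move=> M M0; exists (c^-1 * M); last by rewrite mulrA divff ?mul1r ?gt_eqF.
by rewrite mulr_ge0 // invr_ge0 ltW.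
Qed.

Lemma Kinf_inverse {a} : classKinf a ->
  exists2 b, classKinf b & forall s, 0 <= s -> a (b s) = s.
Proof.
move=> aK; have [a0 _ ai _] := aK.
(* The implication under the existential makes the statement total in [M], so that [choice] applies;
   negative arguments get the junk value 0. *)
have aK' M : exists s, 0 <= M -> 0 <= s /\ a s = M.
  have [M0|_] := boolP (0 <= M); last by exists 0.
  by have [s s0 sM] := Kinf_surj aK _ M0; exists s.
have [b bP] := choice aK'.
have inj s t : 0 <= s -> 0 <= t -> a s = a t -> s = t.
  move=> s0 t0 ast; have [/ai|/ai|//] := ltgtP s t.
  - by move=> /(_ s0); rewrite ast ltxx.
  - by move=> /(_ t0); rewrite ast ltxx.
exists b => [|s /bP[]//]; apply: inc_surj_Kinf.
- have [b0 ab0] := bP 0 (lexx 0).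
  by apply: inj => //; rewrite ab0 a0.
- move=> s t s0 st; have [bs0 abs] := bP s s0.
  have [bt0 abt] := bP t (le_trans s0 (ltW st)).
  rewrite ltNge; apply/negP => /(Kinf_le aK _ _ bt0).
  by rewrite abs abt leNgt st.
- move=> M M0; have aM0 := Kinf_ge0 aK _ M0; exists (a M) => //.
  by have [? ?] := bP _ aM0; apply: inj.
Qed.

Lemma Kinf_gamma_hat {g rho} (eps : R) : classKinf g -> classKinf rho ->
  classKinf (gamma_hat g rho eps).
Proof.
move=> gK rhoK; apply: (Kinf_comp gK (Kinf_comp rhoK (Kinf_scale _ _))).
by rewrite ltr_wpDr ?sqr_ge0.
Qed.

(* With [r := (rho - id)^-1 q], either [p <= r], so [p + q <= r + q = rho r],
   or [q <= rho p - p], so [p + q <= rho p]. *)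
Lemma Kinf_weak_triangle {rho} : classKinf rho ->
  classKinf (fun s => rho s - s) ->
  exists2 sigma, classKinf sigma & forall p q, 0 <= p -> 0 <= q ->
    p + q <= Num.max (rho p) (sigma q).
Proof.
move=> rhoK dK; have [r rK rE] := Kinf_inverse dK.
exists (rho \o r); first exact: Kinf_comp.
move=> p q p0 q0 /=; have rq := rE q q0.
have [pr|/ltW rp] := leP p (r q).
  by rewrite le_max; apply/orP; right; lra.
rewrite le_max; apply/orP; left.
by have := Kinf_le dK _ _ (Kinf_ge0 rK _ q0) rp; rewrite rq; lra.
Qed.

(** Here [z] stands for the squared norm of an internal input, [b] for that of the other subsystem's
    state and [c] for that of the external input. The weak triangle inequality leaves [b] under the
    hat gain and moves the large factor [1 + eps ^- 2] into [delta]. *)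
Lemma gain_split {g rho} {eps : R} : classKinf g -> classKinf rho ->
  classKinf (fun s => rho s - s) ->
  exists2 delta, classKinf delta &
    forall b c z : R, 0 <= b -> 0 <= c -> 0 <= z ->
      z <= (1 + eps ^+ 2) * b + (1 + eps ^- 2) * c ->
      g z <= Num.max (gamma_hat g rho eps b) (delta c).
Proof.
move=> gK rhoK /(Kinf_weak_triangle rhoK)[sigma sK tri].
have eps2 : 0 <= eps ^- 2 by rewrite invr_ge0 sqr_ge0.
have k0 : 0 < 1 + eps ^- 2 by rewrite ltr_wpDr.
exists (g \o (sigma \o (fun c => (1 + eps ^- 2) * c))).
  by do 2 apply: Kinf_comp => //; exact: Kinf_scale.
move=> b c z b0 c0 z0 zle /=; rewrite /gamma_hat.
have p0 : 0 <= (1 + eps ^+ 2) * b by rewrite mulr_ge0 ?addr_ge0 ?sqr_ge0.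
have q0 : 0 <= (1 + eps ^- 2) * c by rewrite mulr_ge0 // ltW.
rewrite -(Kinf_max gK) ?(Kinf_ge0 rhoK) ?(Kinf_ge0 sK) //.
by apply: (Kinf_le gK) => //; exact: le_trans (tri _ _ p0 q0).
Qed.

(** [u] and [v] are the squared norms of the two substates; exchanging their roles gives the bound
    on [v]. The sum [m + g1 m] dominates both alternatives [u <= m] and [u <= g1 m]. *)
Lemma small_gain_bound {g1 g2} : classKinf g1 -> classKinf g2 ->
  classKinf (fun s => s - g1 (g2 s)) ->
  forall u v m, 0 <= u -> 0 <= v -> 0 <= m ->
    u <= Num.max m (g1 v) -> v <= Num.max m (g2 u) -> u <= m + g1 m.
Proof.
move=> g1K g2K [sg0 _ sgi _] u v m u0 v0 m0.
have g1m := Kinf_ge0 g1K _ m0.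
rewrite !le_max => /orP[um _|ug]; first by lra.
move=> /orP[/(Kinf_le g1K _ _ v0)|/(Kinf_le g1K _ _ v0) vg]; first by lra.
(* What remains is [u <= g1 v <= g1 (g2 u)]; for [u > 0] this contradicts [u - g1 (g2 u) > 0], which
   is strict monotonicity between 0 and [u]. *)
have [->|un0] := eqVneq u 0; first by lra.
have : 0 < u by rewrite lt_def un0.
by move=> /(sgi _ _ (lexx 0)); rewrite sg0; lra.
Qed.

End Kinf.

(** * Euclidean norm, coordinates and Young's inequality *)

Section EuclideanNorm.
Set Implicit Arguments.
Unset Strict Implicit.
Variables (R : realType) (n : nat).
Implicit Types x y : 'cV[R]_n.

Lemma enorm_ge0 x : 0 <= enorm x.
Proof. exact: sqrtr_ge0. Qed.

Lemma sqr_enorm x : enorm x ^+ 2 = \sum_i x i 0 ^+ 2.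
Proof. by rewrite sqr_sqrtr // sumr_ge0 // => i _; exact: sqr_ge0. Qed.

Lemma sqr_coord_le x i : x i 0 ^+ 2 <= enorm x ^+ 2.
Proof.
rewrite sqr_enorm (bigD1 i) //= lerDl sumr_ge0 // => j _; exact: sqr_ge0.
Qed.

Lemma normr_coord_le x i : `|x i 0| <= enorm x.
Proof.
by rewrite -(ler_pXn2r (ltn0Sn 1)) ?nnegrE ?enorm_ge0 // real_normK ?num_real ?sqr_coord_le.
Qed.

Lemma sqr_enormD_le (e : R) x y : 0 < e ->
  enorm (x + y) ^+ 2 <=
  (1 + e ^+ 2) * enorm x ^+ 2 + (1 + e ^- 2) * enorm y ^+ 2.
Proof.
move=> e0; rewrite !sqr_enorm !mulr_sumr -big_split /=.
apply: ler_sum => i _; rewrite mxE -subr_ge0.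
(* In each coordinate the gap in Young's inequality is a perfect square, since the cross term
   [2 * e * e^-1] reduces to 2. *)
suff -> : (1 + e ^+ 2) * x i 0 ^+ 2 + (1 + e ^- 2) * y i 0 ^+ 2 -
  (x i 0 + y i 0) ^+ 2 = (e * x i 0 - e^-1 * y i 0) ^+ 2 by exact: sqr_ge0.
by field; rewrite gt_eqF.
Qed.

End EuclideanNorm.

(** * Norms of the two blocks of a stacked vector *)

Section SubVectors.
Set Implicit Arguments.
Unset Strict Implicit.
Variables (R : realType) (n1 n2 : nat).
Implicit Types x : 'cV[R]_(n1 + n2).

Lemma sqr_enorm_split x :
  enorm x ^+ 2 = enorm (usubmx x) ^+ 2 + enorm (dsubmx x) ^+ 2.
Proof.
rewrite !sqr_enorm big_split_ord /=.
by congr (_ + _); apply: eq_bigr => i _; rewrite mxE.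
Qed.

Lemma enorm_usubmx_le x : enorm (usubmx x) <= enorm x.
Proof.
rewrite -(ler_pXn2r (ltn0Sn 1)) ?nnegrE ?enorm_ge0 //.
by rewrite (sqr_enorm_split x) lerDl sqr_ge0.
Qed.

Lemma enorm_dsubmx_le x : enorm (dsubmx x) <= enorm x.
Proof.
rewrite -(ler_pXn2r (ltn0Sn 1)) ?nnegrE ?enorm_ge0 //.
by rewrite (sqr_enorm_split x) lerDr sqr_ge0.
Qed.

End SubVectors.

(** * Transfer from Borel sets to the completed Lebesgue measure *)

Section LebesgueMeasure.
Set Implicit Arguments.
Unset Strict Implicit.
Variable R : realType.
Local Notation L := (lebesgueTypeR R).

Lemma borel_measurable_lebesgue (A : set R) :
  measurable A -> measurable (A : set L).
Proof. exact: sub_caratheodory. Qed.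

Lemma lebesgue_measurable_itv (i : interval R) : measurable ([set` i] : set L).
Proof. apply: borel_measurable_lebesgue. exact: measurable_itv. Qed.

Lemma completed_lebesgue_segment_lty (a b : R) :
  (completed_lebesgue_measure (`[a, b] : set L) < +oo)%E.
Proof.
(* Both measures restrict the same outer measure, so their values on a segment agree by
   computation. *)
have -> : completed_lebesgue_measure (`[a, b] : set L) =
  lebesgue_measure (`[a, b] : set R) by [].
by rewrite lebesgue_measure_itv; case: ifP => _; rewrite -?EFinB ltry.
Qed.

Lemma within_continuous_lebesgue_measurable (i : interval R) (f : R -> R) :
  {within [set` i], continuous f} -> measurable_fun ([set` i] : set L) f.
Proof.
move=> cf _ B mB; apply: borel_measurable_lebesgue.
exact: (subspace_continuous_measurable_fun (measurable_itv i) cf).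
Qed.

Lemma ae_lebesgue_filter :
  Filter (almost_everywhere (@completed_lebesgue_measure R)).
Proof.
exact: (ae_filter_ringOfSetsType
  (completed_lebesgue_measure : {measure set L -> \bar R})).
Qed.

End LebesgueMeasure.

(** * Trajectories and blocks as admissible inputs; integrability *)

Section AdmissibleInputs.
Set Implicit Arguments.
Unset Strict Implicit.
Variable R : realType.
Local Notation L := (lebesgueTypeR R).

Lemma locally_AC_continuous n (x : R -> 'cV[R]_n) i : locally_AC x ->
  {within `[0, +oo[, continuous (fun t => x t i 0)}.
Proof.
move=> xAC; apply/subspace_continuousP => t /=; rewrite in_itv/= andbT => t0.
apply/cvgrPdist_lt => e e0.
(* The horizon [t + 1], with [s] within 1 of [t], leaves room on both sides of [t]. Absolute
   continuity is then used for the single interval between [s] and [t], in either order. *)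
have [d d0 xd] := xAC (t + 1) e ltac:(lra) e0.
rewrite near_withinE; near=> s; rewrite /= in_itv/= andbT => s0.
have st : `|t - s| < Num.min d 1.
  by near: s; apply: cvgr_dist_lt => //; rewrite lt_min d0 ltr01.
have {xd}xd (p q : R) : 0 <= p -> p <= q -> q <= t + 1 -> q - p < d ->
    enorm (x q - x p) < e.
  move=> p0 pq qt pqd; have := xd [:: (p, q)].
  by rewrite !big_seq1 /= p0 pq qt; exact.
move: st; rewrite lt_min => /andP[std st1].
have [ts|/ltW ts] := leP t s.
  rewrite distrC; apply: le_lt_trans (xd t s _ _ _ _) => //; first last.
  - by move: std; rewrite distrC ger0_norm ?subr_ge0.
  - by move: st1; rewrite distrC ger0_norm ?subr_ge0 //; lra.
  by have := normr_coord_le (x s - x t) i; rewrite !mxE.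
apply: le_lt_trans (xd s t _ _ _ _) => //; first last.
- by move: std; rewrite ger0_norm ?subr_ge0.
- by lra.
by have := normr_coord_le (x t - x s) i; rewrite !mxE.
Unshelve. all: by end_near. Qed.

(** This lets the state of one subsystem be fed to the other. Continuity gives measurability, and
    the extreme value theorem bounds each coordinate on [[0, T]]. *)
Lemma locally_AC_admissible n (x : R -> 'cV[R]_n) :
  locally_AC x -> admissible_input x.
Proof.
move=> xAC; split=> [i|T T0].
  exact/within_continuous_lebesgue_measurable/locally_AC_continuous.
have bnd i : exists M, forall t, 0 <= t <= T -> `|x t i 0| <= M.
  have xc : {within `[0, T], continuous (fun t => `|x t i 0|)}.
    have : {within `[0, T], continuous (fun t => x t i 0)}.
      apply: (@continuous_subspaceW _ _ `[0, T] `[0, +oo[) => [t /=|].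
        by rewrite !in_itv/= => /andP[->].
      exact: locally_AC_continuous.
    by move=> xc t; apply: cvg_norm; exact: xc.
  have [c _ cM] := EVT_max T0 xc; exists `|x c i 0| => t tT.
  exact: cM.
have [M xM] := choice bnd.
exists (Num.sqrt (\sum_i M i ^+ 2)); apply: aeW => t tT.
rewrite ler_sqrt ?sumr_ge0 // => [|i _]; last exact: sqr_ge0.
apply: ler_sum => i _; rewrite -real_normK ?num_real ?lerXn2r ?nnegrE //; last exact: xM.
exact: le_trans (xM i t tT).
Qed.

Lemma admissibleD n (w v : R -> 'cV[R]_n) :
  admissible_input w -> admissible_input v ->
  admissible_input (fun t => w t + v t).
Proof.
move=> [mw bw] [mv bv]; split=> [i|T T0].
  have -> : (fun t => (w t + v t) i 0) = (fun t => w t i 0 + v t i 0).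
    by apply/funext => t; rewrite mxE.
  exact: measurable_funD.
have [M wM] := bw T T0; have [N vN] := bv T T0.
(* Young's inequality with [e = 1] produces both factors 2. *)
exists (Num.sqrt (2 * M ^+ 2 + 2 * N ^+ 2)).
move: wM vN; apply: (@filterS2 _ _ (ae_lebesgue_filter R)) => t wM vN tT.
have {}wM := wM tT; have {}vN := vN tT.
have M0 := le_trans (enorm_ge0 _) wM; have N0 := le_trans (enorm_ge0 _) vN.
have S0 : 0 <= 2 * M ^+ 2 + 2 * N ^+ 2 by rewrite addr_ge0 ?mulr_ge0 ?sqr_ge0.
rewrite -(ler_pXn2r (ltn0Sn 1)) ?nnegrE ?enorm_ge0 ?sqrtr_ge0 //.
rewrite [leRHS]sqr_sqrtr //; apply: le_trans (sqr_enormD_le (w t) (v t) ltr01) _.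
rewrite expr1n invr1; apply: lerD; rewrite ler_pM2l // lerXn2r ?nnegrE //.
- exact: enorm_ge0.
- exact: enorm_ge0.
Qed.

(** Common source of the two block lemmas below: [h] selects coordinates, which preserves
    measurability, and the norm comparison preserves the essential bound. *)
Lemma admissible_coords n n' (w : R -> 'cV[R]_n) (v : R -> 'cV[R]_n')
    (h : 'I_n' -> 'I_n) :
  (forall t i, v t i 0 = w t (h i) 0) ->
  (forall t, enorm (v t) <= enorm (w t)) ->
  admissible_input w -> admissible_input v.
Proof.
move=> vw vw_le [mw bw]; split=> [i|T T0].
  have -> : (fun t => v t i 0) = (fun t => w t (h i) 0) by apply/funext.
  exact: mw.
have [M wM] := bw T T0; exists M; apply: (@filterS _ _ (ae_lebesgue_filter R) _ _ _ wM) => t {}wM tT.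
exact: le_trans (wM tT).
Qed.

Lemma admissible_usubmx n1 n2 (w : R -> 'cV[R]_(n1 + n2)) :
  admissible_input w -> admissible_input (fun t => usubmx (w t)).
Proof.
apply: (@admissible_coords _ _ _ _ (lshift n2)) => t; last exact: enorm_usubmx_le.
by move=> i; rewrite mxE.
Qed.

Lemma admissible_dsubmx n1 n2 (w : R -> 'cV[R]_(n1 + n2)) :
  admissible_input w -> admissible_input (fun t => dsubmx (w t)).
Proof.
apply: (@admissible_coords _ _ _ _ (@rshift n1 n2)) => t; last exact: enorm_dsubmx_le.
by move=> i; rewrite mxE.
Qed.

Lemma admissible_integrable n (w : R -> 'cV[R]_n) t :
  0 <= t -> admissible_input w ->
  completed_lebesgue_measure.-integrable (`[0, t] : set L)
    (EFin \o (fun s => enorm (w s) ^+ 2)).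
Proof.
move=> t0 [mw bw].
have mt : measurable (`[0, t] : set L) := lebesgue_measurable_itv _.
have mf : measurable_fun (`[0, t] : set L) (fun s => enorm (w s) ^+ 2).
  have -> : (fun s => enorm (w s) ^+ 2) = (fun s => \sum_i w s i 0 ^+ 2).
    by apply/funext => s; exact: sqr_enorm.
  apply: measurable_sum => i; apply: measurable_funX.
  apply: measurable_funS (mw i); first exact: lebesgue_measurable_itv.
  by move=> s /=; rewrite !in_itv/= => /andP[->].
have [M wM] := bw t t0.
apply/integrableP; split; first exact/measurable_EFinP.
pose mu : {measure set L -> \bar R} := completed_lebesgue_measure.
(* The essential bound [M] holds only almost everywhere, hence the almost-everywhere comparison with
   the constant [M ^+ 2], whose integral over a segment is finite. *)
have le_cst : (\int[mu]_(s in `[0%R, t]) `|(enorm (w s) ^+ 2)%R%:E| <=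
    \int[mu]_(s in `[0%R, t]) (cst (M ^+ 2)%R%:E) s)%E.
  apply: ae_ge0_le_integral => //.
  - by apply: measurableT_comp => //; exact/measurable_EFinP.
  - by move=> s _; rewrite lee_fin sqr_ge0.
  - apply: (@filterS _ _ (ae_lebesgue_filter R) _ _ _ wM) => s {}wM; rewrite /= in_itv /= => /wM {}wM.
    rewrite lee_fin ger0_norm ?sqr_ge0 // lerXn2r ?nnegrE ?enorm_ge0 //.
    exact: le_trans (enorm_ge0 _) wM.
apply: le_lt_trans le_cst _.
rewrite integral_cst //; apply: lte_mul_pinfty => //; rewrite ?lee_fin ?sqr_ge0 //.
exact: completed_lebesgue_segment_lty.
Qed.

End AdmissibleInputs.

(** * Squared L2 norms of sums and of stacked signals *)

Section L2Norm.
Set Implicit Arguments.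
Unset Strict Implicit.
Variable R : realType.

Lemma L2sq_ge0 n (w : R -> 'cV[R]_n) t : 0 <= L2sq w t.
Proof. by apply: Rintegral_ge0 => s _; exact: sqr_ge0. Qed.

Lemma L2sqD_le n (e : R) (w v : R -> 'cV[R]_n) t : 0 < e -> 0 <= t ->
  admissible_input w -> admissible_input v ->
  L2sq (fun s => w s + v s) t <=
  (1 + e ^+ 2) * L2sq w t + (1 + e ^- 2) * L2sq v t.
Proof.
move=> e0 t0 aw av; rewrite /L2sq.
have mt := lebesgue_measurable_itv (`[0, t] : interval R).
have iw := admissible_integrable t0 aw.
have iv := admissible_integrable t0 av.
have iZ k (f : lebesgueTypeR R -> R) : completed_lebesgue_measure.-integrable `[0, t] (EFin \o f) ->
    completed_lebesgue_measure.-integrable `[0, t] (EFin \o (fun s => k * f s)).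
  by move=> fi; exact: (integrableZl mt k fi).
have iwv := integrableD mt (iZ (1 + e ^+ 2) _ iw) (iZ (1 + e ^- 2) _ iv).
rewrite -!RintegralZl // -RintegralD //; [|exact: iZ..].
apply: le_Rintegral => //.
  exact/admissible_integrable/admissibleD.
by move=> s _; exact: sqr_enormD_le.
Qed.

Lemma L2sq_split n1 n2 (w : R -> 'cV[R]_(n1 + n2)) t : 0 <= t ->
  admissible_input w ->
  L2sq w t = L2sq (fun s => usubmx (w s)) t + L2sq (fun s => dsubmx (w s)) t.
Proof.
move=> t0 aw; rewrite /L2sq -RintegralD.
- by apply: eq_Rintegral => s _; exact: sqr_enorm_split.
- exact: lebesgue_measurable_itv.
- exact/admissible_integrable/admissible_usubmx.
- exact/admissible_integrable/admissible_dsubmx.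
Qed.

End L2Norm.

(** * Projecting a solution of the interconnection onto each subsystem *)

Section Trajectories.
Set Implicit Arguments.
Unset Strict Implicit.
Variable R : realType.

Lemma is_derive_mxP n (x : R -> 'cV[R]_n) (t : R) (l : 'cV[R]_n) :
  is_derive t 1 x l <-> forall i, is_derive t 1 (fun s => x s i 0) (l i 0).
Proof.
split=> [[dx <-] i|dx].
  have /derivable_mxP/(_ i 0) dxi := dx.
  by split=> //; rewrite derive_mx // mxE.
have dx' : derivable x t 1.
  by apply/derivable_mxP => i j; rewrite ord1; case: (dx i).
split=> //; rewrite derive_mx //; apply/matrixP => i j.
by rewrite mxE ord1; case: (dx i).
Qed.

Lemma locally_AC_contraction n n' (h : 'cV[R]_n -> 'cV[R]_n') x :
  (forall u v, enorm (h u - h v) <= enorm (u - v)) ->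
  locally_AC x -> locally_AC (h \o x).
Proof.
move=> h_le xAC T e T0 e0; have [d d0 xd] := xAC T e T0 e0.
exists d => // s sT s_disj sd; apply: le_lt_trans (xd s sT s_disj sd).
by apply: ler_sum => p _; exact: h_le.
Qed.

(** A selection of coordinates is linear and, being bounded by the norm, a contraction: it preserves
    absolute continuity and commutes with differentiation. The third hypothesis is needed only along
    the given trajectory. *)
Lemma solution_coords n m n' m' (f : 'cV[R]_n -> 'cV[R]_m -> 'cV[R]_n)
    (f' : 'cV[R]_n' -> 'cV[R]_m' -> 'cV[R]_n')
    w w' x (h : 'cV[R]_n -> 'cV[R]_n') (k : 'I_n' -> 'I_n) :
  (forall v i, h v i 0 = v (k i) 0) ->
  (forall v, enorm (h v) <= enorm v) ->
  (forall t, h (f (x t) (w t)) = f' (h (x t)) (w' t)) ->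
  solution f w x -> solution f' w' (h \o x).
Proof.
move=> hE h_le hf [xAC dx]; split.
  apply: locally_AC_contraction xAC => u v.
  rewrite (_ : h u - h v = h (u - v)) //.
  by apply/matrixP => i j; rewrite !mxE ord1 !hE !mxE.
apply: (@filterS _ _ (ae_lebesgue_filter R) _ _ _ dx) => t {}dx t0.
apply/is_derive_mxP => i /=; rewrite -hf hE.
have /is_derive_mxP/(_ (k i)) := dx t0.
by congr is_derive; apply/funext => s; rewrite hE.
Qed.

Variables n1 n2 : nat.
Variables (f1 : 'cV[R]_n1 -> 'cV[R]_n2 -> 'cV[R]_n1)
          (f2 : 'cV[R]_n2 -> 'cV[R]_n1 -> 'cV[R]_n2).

Lemma interconnection_solution_fst eta x :
  solution (interconnection f1 f2) eta x ->
  solution f1 (fun t => dsubmx (x t) + usubmx (eta t)) (fun t => usubmx (x t)).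
Proof.
apply: (@solution_coords _ _ _ _ _ _ _ _ _ (@usubmx _ n1 n2 1) (lshift n2)).
- by move=> v i; rewrite mxE.
- exact: enorm_usubmx_le.
- by move=> t; rewrite col_mxKu.
Qed.

Lemma interconnection_solution_snd eta x :
  solution (interconnection f1 f2) eta x ->
  solution f2 (fun t => usubmx (x t) + dsubmx (eta t)) (fun t => dsubmx (x t)).
Proof.
apply: (@solution_coords _ _ _ _ _ _ _ _ _ (@dsubmx _ n1 n2 1) (@rshift n1 n2)).
- by move=> v i; rewrite mxE.
- exact: enorm_dsubmx_le.
- by move=> t; rewrite col_mxKd.
Qed.

End Trajectories.

Theorem theorem5 (R : realType) (n1 n2 : nat)
    (f1 : 'cV[R]_n1 -> 'cV[R]_n2 -> 'cV[R]_n1)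
    (f2 : 'cV[R]_n2 -> 'cV[R]_n1 -> 'cV[R]_n2)
    (beta1 beta2 gamma1 gamma2 rho : R -> R) (eps : R)
    (f1_lip : locally_lipschitz_fst f1)
    (f2_lip : locally_lipschitz_fst f2)
    (f1_fc : forward_complete f1)
    (f2_fc : forward_complete f2)
    (beta1_K : classKinf beta1)
    (beta2_K : classKinf beta2)
    (gamma1_K : classKinf gamma1)
    (gamma2_K : classKinf gamma2)
    (f1_gain : L2_gain_estimate f1 beta1 gamma1)
    (f2_gain : L2_gain_estimate f2 beta2 gamma2)
    (inter_fc : forward_complete (interconnection f1 f2))
    (eps_gt0 : 0 < eps)
    (rho_K : classKinf rho)
    (rho_id_K : classKinf (fun s => rho s - s))
    (small_gain12 : classKinf (fun s =>
       s - gamma_hat gamma1 rho eps (gamma_hat gamma2 rho eps s)))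
    (small_gain21 : classKinf (fun s =>
       s - gamma_hat gamma2 rho eps (gamma_hat gamma1 rho eps s))) :
  nonlinear_L2_gain (interconnection f1 f2).
Proof.
have [delta1 delta1_K split1] := gain_split (eps := eps) gamma1_K rho_K rho_id_K.
have [delta2 delta2_K split2] := gain_split (eps := eps) gamma2_K rho_K rho_id_K.
have g1K := Kinf_gamma_hat eps gamma1_K rho_K.
have g2K := Kinf_gamma_hat eps gamma2_K rho_K.
move: g1K g2K small_gain12 small_gain21 split1 split2.
set g1 := gamma_hat gamma1 rho eps; set g2 := gamma_hat gamma2 rho eps.
move=> g1K g2K sg12 sg21 split1 split2.
have BK := Kinf_add beta1_K beta2_K.
have DK := Kinf_add delta1_K delta2_K.
(* Sum of the two bounds that [small_gain_bound] gives for the substates. *)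
pose K s := (s + g1 s) + (s + g2 s).
have idK : classKinf (fun s : R => s).
  by have := Kinf_scale 1 (ltr01 : 0 < 1 :> R); under eq_fun do rewrite mul1r.
have KK : classKinf K by do !apply: Kinf_add.
exists (K \o (fun s => beta1 s + beta2 s)), (K \o (fun s => delta1 s + delta2 s)).
split=> [||eta x a_eta sol t t0]; [exact: Kinf_comp..|].
have a_x := locally_AC_admissible sol.1.
have [au ad] := (admissible_usubmx a_x, admissible_dsubmx a_x).
have [eu ed] := (admissible_usubmx a_eta, admissible_dsubmx a_eta).
(* Each block of [x] solves its own subsystem, with the other block plus the external input as its
   input. *)
have E1 := f1_gain _ _ (admissibleD ad eu) (interconnection_solution_fst sol) t t0.
have E2 := f2_gain _ _ (admissibleD au ed) (interconnection_solution_snd sol) t t0.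
have S1 := split1 _ _ _ (L2sq_ge0 _ _) (L2sq_ge0 _ _) (L2sq_ge0 _ _)
  (L2sqD_le eps_gt0 t0 ad eu).
have S2 := split2 _ _ _ (L2sq_ge0 _ _) (L2sq_ge0 _ _) (L2sq_ge0 _ _)
  (L2sqD_le eps_gt0 t0 au ed).
rewrite /= (L2sq_split t0 a_x).
have etaE := L2sq_split t0 a_eta.
have u0 := L2sq_ge0 (fun s => usubmx (x s)) t.
have v0 := L2sq_ge0 (fun s => dsubmx (x s)) t.
have c0 := L2sq_ge0 (fun s => usubmx (eta s)) t.
have d0 := L2sq_ge0 (fun s => dsubmx (eta s)) t.
have r0 := enorm_ge0 (x 0).
have B1 := Kinf_le beta1_K _ _ (enorm_ge0 _) (enorm_usubmx_le (x 0)).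
have B2 := Kinf_le beta2_K _ _ (enorm_ge0 _) (enorm_dsubmx_le (x 0)).
have e0 : 0 <= L2sq eta t := L2sq_ge0 _ _.
have D1 : delta1 (L2sq (fun s => usubmx (eta s)) t) <= delta1 (L2sq eta t).
  by apply: (Kinf_le delta1_K) => //; rewrite etaE lerDl.
have D2 : delta2 (L2sq (fun s => dsubmx (eta s)) t) <= delta2 (L2sq eta t).
  by apply: (Kinf_le delta2_K) => //; rewrite etaE lerDr.
have b10 := Kinf_ge0 beta1_K _ r0; have b20 := Kinf_ge0 beta2_K _ r0.
have d10 := Kinf_ge0 delta1_K _ e0; have d20 := Kinf_ge0 delta2_K _ e0.
(* Monotonicity of [K] pulls it out of the maximum, so the goal becomes a bound by [K m]. *)
rewrite -(Kinf_max KK) ?(Kinf_ge0 BK) ?(Kinf_ge0 DK) //.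
set m := Num.max _ _.
have m0 : 0 <= m by rewrite le_max addr_ge0.
have mB : beta1 (enorm (x 0)) + beta2 (enorm (x 0)) <= m by rewrite le_max lexx.
have mD : delta1 (L2sq eta t) + delta2 (L2sq eta t) <= m.
  by rewrite le_max lexx orbT.
(* Three alternatives arise: the [beta1] term and the [delta1] term are each at most [m], being
   summands of nonnegative sums below [m]; the hat gain term is kept. *)
have F1 : L2sq (fun s => usubmx (x s)) t <=
    Num.max m (g1 (L2sq (fun s => dsubmx (x s)) t)).
  move: E1; rewrite le_max => /orP[E1|/le_trans/(_ S1)].
    by rewrite le_max; apply/orP; left; lra.
  by rewrite !le_max => /orP[->|E1]; rewrite ?orbT //; apply/orP; left; lra.
have F2 : L2sq (fun s => dsubmx (x s)) t <=
    Num.max m (g2 (L2sq (fun s => usubmx (x s)) t)).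
  move: E2; rewrite le_max => /orP[E2|/le_trans/(_ S2)].
    by rewrite le_max; apply/orP; left; lra.
  by rewrite !le_max => /orP[->|E2]; rewrite ?orbT //; apply/orP; left; lra.
by apply: lerD; [exact: small_gain_bound sg12 _ _ _ _ _ _ F1 F2|
                 exact: small_gain_bound sg21 _ _ _ _ _ _ F2 F1].
Qed.
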